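(* Let $f:\mathbb{GA}_N\rightarrow\mathbb{G\overline A}_N$ ($N>1$) be an equitorsion second type almost geodesic mapping of the first kind which satisfies the property of reciprocity. Then $$\begin{aligned}\mathcal W^i_{jmn}=\;&R^i_{jmn}+\tfrac1{N+1}\delta^i_jR_{[mn]}+\tfrac N{N^2-1}\big(\delta^i_mR_{jn}-\delta^i_nR_{jm}\big)+\tfrac1{N^2-1}\big(\delta^i_mR_{nj}-\delta^i_nR_{mj}\big)\\&+\mathcal F^i_{jmn}+\tfrac1{N+1}\delta^i_j\mathcal F_{[mn]}+\tfrac N{N^2-1}\big(\delta^i_m\mathcal F_{jn}-\delta^i_n\mathcal F_{jm}\big)+\tfrac1{N^2-1}\big(\delta^i_m\mathcal F_{nj}-\delta^i_n\mathcal F_{mj}\big)\end{aligned}$$ is an invariant of $f$; that is, $\overline{\mathcal W}^i_{jmn}=\mathcal W^i_{jmn}$, where $\overline{\mathcal W}^i_{jmn}$ is the object of $\mathbb{G\overline A}_N$ defined by the same formula. Here $R^i_{jmn}$, $R_{jm}$, $\mathcal F^i_{jmn}$, $\mathcal F_{jm}$ and their barred counterparts are as defined in the context.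
   Context: A non-symmetric affine connection space $\mathbb{GA}_N$ is an $N$-dimensional manifold with an affine connection whose coefficients $L^i_{jk}$ need not be symmetric in $j,k$. Its symmetric part and torsion are $\widetilde S^i_{jk}=\frac12(L^i_{jk}+L^i_{kj})$ and $\widetilde T^i_{jk}=\frac12(L^i_{jk}-L^i_{kj})$. Objects of $\mathbb{G\overline A}_N$ carry a bar. All equations are in a coordinate system common with respect to the mapping $f$ (corresponding points have equal coordinates). The summation convention is used, a comma denotes a partial derivative, and $[ij]$ denotes anti-symmetrization without division, $a_{[ij]}=a_{ij}-a_{ji}$. Covariant derivative of the first kind in $\mathbb{GA}_N$: $a^i_{j\underset1|k}=a^i_{j,k}+L^i_{\alpha k}a^\alpha_j-L^\alpha_{jk}a^i_\alpha$, and analogously for objects with other numbers of indices (e.g. $\sigma_{j\underset1|n}=\sigma_{j,n}-L^\alpha_{jn}\sigma_\alpha$). The same operation with $\overline L^i_{jk}$ is denoted $\underset1\|$. A mapping $f:\mathbb{GA}_N\to\mathbb{G\overline A}_N$ is a second type almost geodesic mapping of the first kind if there are covectors $\psi_j,\sigma_j,\mu_j,\nu_j$, an affinor (a $(1,1)$-tensor) $F^i_j$ and a tensor $\xi^i_{jk}$ anti-symmetric in $j,k$ with $$\overline L^i_{jk}=L^i_{jk}+\psi_j\delta^i_k+\psi_k\delta^i_j+\sigma_jF^i_k+\sigma_kF^i_j+\xi^i_{jk},$$ $$F^i_{j\underset1|k}+F^i_{k\underset1|j}+F^i_\alpha F^\alpha_j\sigma_k+F^i_\alpha F^\alpha_k\sigma_j-\big(\xi^i_{j\alpha}F^\alpha_k+\xi^i_{k\alpha}F^\alpha_j\big)=\mu_jF^i_k+\mu_kF^i_j+\nu_j\delta^i_k+\nu_k\delta^i_j.$$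 It is equitorsion if $\widetilde{\overline T}{}^i_{jk}=\widetilde T^i_{jk}$, i.e. $\xi^i_{jk}=0$. It satisfies the property of reciprocity if it preserves $F^i_j$ and its inverse is a second type almost geodesic mapping of the first kind; this is equivalent to $F^i_\alpha F^\alpha_j=e\delta^i_j$ with $e\in\{0,1,-1\}$. In that case the objects determining $f^{-1}$ are $\overline\psi_j=-\psi_j$, $\overline\sigma_j=-\sigma_j$, $\overline F^i_j=F^i_j$. With $F=F^\alpha_\alpha$, put $$\begin{aligned}\omega^i_{jk}=&-\tfrac12(\sigma_jF^i_k+\sigma_kF^i_j)+\tfrac1{N+1}\big(L^\alpha_{j\alpha}\delta^i_k+L^\alpha_{k\alpha}\delta^i_j\big)\\&+\tfrac1{2(N+1)}\Big(\big(\sigma_jF+\sigma_\alpha F^\alpha_j\big)\delta^i_k+\big(\sigma_kF+\sigma_\alpha F^\alpha_k\big)\delta^i_j\Big).\end{aligned}$$ The paper's curvature object of the associated space $\mathbb A_N$ (the space with connection coefficients $\widetilde S^i_{jk}$) is $R^i_{jmn}=\widetilde S^i_{jm;n}-\widetilde S^i_{jn;m}$, where the semicolon is the covariant derivative with respect to $\widetilde S$ applied formally to the coefficients: $$\widetilde S^i_{jm;n}=\widetilde S^i_{jm,n}+\widetilde S^i_{\alpha n}\widetilde S^\alpha_{jm}-\widetilde S^\alpha_{jn}\widetilde S^i_{\alpha m}-\widetilde S^\alpha_{mn}\widetilde S^i_{j\alpha}.$$ Further, $R_{jm}=R^\alpha_{jm\alpha}$. Finally, $$\begin{aligned}\mathcal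 F^i_{jmn}=\;&\tfrac12\big(\sigma_{j\underset1|n}F^i_m+\sigma_{m\underset1|n}F^i_j+\sigma_jF^i_{m\underset1|n}+\sigma_mF^i_{j\underset1|n}\big)\\&-\tfrac12\big(\sigma_{j\underset1|m}F^i_n+\sigma_{n\underset1|m}F^i_j+\sigma_jF^i_{n\underset1|m}+\sigma_nF^i_{j\underset1|m}\big)\\&-2\widetilde S^i_{\alpha n}\widetilde S^\alpha_{jm}+2\widetilde S^\alpha_{jn}\widetilde S^i_{\alpha m}\\&+\omega^\alpha_{jm}L^i_{\alpha n}+\omega^i_{\alpha n}L^\alpha_{jm}-\omega^i_{\alpha m}L^\alpha_{jn}-\omega^\alpha_{jn}L^i_{\alpha m}-2\omega^i_{j\alpha}\widetilde T^\alpha_{mn},\end{aligned}$$ and $\mathcal F_{jm}=\mathcal F^\alpha_{jm\alpha}$. All barred objects ($\overline\omega$, $\overline R$, $\overline{\mathcal F}$, $\overline{\mathcal W}$) are given by the same formulas with $L,\widetilde S,\widetilde T,\sigma,F,\underset1|$ replaced by $\overline L,\widetilde{\overline S},\widetilde{\overline T},\overline\sigma,\overline F,\underset1\|$. *)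

(* Defs.v *)
From HB Require Import structures.
From mathcomp Require Import all_boot all_order all_algebra.
From mathcomp Require Import all_classical all_reals all_analysis.
Set Implicit Arguments.
Unset Strict Implicit.
Unset Printing Implicit Defensive.
Import Order.TTheory GRing.Theory Num.Theory.
Import numFieldNormedType.Exports.
Local Open Scope classical_set_scope.
Local Open Scope ring_scope.

(* Index conventions: indices are elements of 'I_N; upper indices come first,
   so [L x i j k] is L^i_{jk} at x and [F x i j] is F^i_j at x. *)

Section Coordinates.
Variables (R : realType) (N : nat).
Local Notation I := 'I_N.
Local Notation pt := 'rV[R]_N.

Definition partial (k : I) (g : pt -> R) : pt -> R := 'D_(delta_mx 0 k) g.

Fixpoint Ck (n : nat) (U : set pt) (g : pt -> R) : Prop :=
  (forall x, U x -> {for x, continuous g}) /\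
  match n with
  | 0 => True
  | n'.+1 => forall k : I,
      (forall x, U x -> derivable g x (delta_mx 0 k)) /\ Ck n' U (partial k g)
  end.

(* Only used for open U. *)
Definition smooth (U : set pt) (g : pt -> R) : Prop := forall n, Ck n U g.

Definition kron (i j : I) : R := (i == j)%:R.

Definition sym_part (L : pt -> I -> I -> I -> R) (x : pt) (i j k : I) : R :=
  2^-1 * (L x i j k + L x i k j).

Definition torsion (L : pt -> I -> I -> I -> R) (x : pt) (i j k : I) : R :=
  2^-1 * (L x i j k - L x i k j).

(* Covariant derivatives of the first kind; the last index is the one of
   differentiation. *)
Definition cov1_covector (L : pt -> I -> I -> I -> R) (s : pt -> I -> R)
    (x : pt) (j n : I) : R :=
  partial n (fun y => s y j) x - \sum_a L x a j n * s x a.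

Definition cov1_affinor (L : pt -> I -> I -> I -> R) (F : pt -> I -> I -> R)
    (x : pt) (i j k : I) : R :=
  partial k (fun y => F y i j) x
  + \sum_a L x i a k * F x a j - \sum_a L x a j k * F x i a.

Definition omega (L : pt -> I -> I -> I -> R) (s : pt -> I -> R)
    (F : pt -> I -> I -> R) (x : pt) (i j k : I) : R :=
  let trF := \sum_a F x a a in
  let trL j := \sum_a L x a j a in
  let sF j := \sum_a s x a * F x a j in
  - (2^-1 * (s x j * F x i k + s x k * F x i j))
  + (N%:R + 1)^-1 * (trL j * kron i k + trL k * kron i j)
  + (2 * (N%:R + 1))^-1 *
      ((s x j * trF + sF j) * kron i k + (s x k * trF + sF k) * kron i j).

(* Covariant derivative of the coefficients S^i_{jm} with respect to
   themselves, applied formally as to a tensor: S^i_{jm;n}. *)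
Definition semicolon (S : pt -> I -> I -> I -> R) (x : pt) (i j m n : I) : R :=
  partial n (fun y => S y i j m) x
  + \sum_a S x i a n * S x a j m
  - \sum_a S x a j n * S x i a m
  - \sum_a S x a m n * S x i j a.

Definition curv (L : pt -> I -> I -> I -> R) (x : pt) (i j m n : I) : R :=
  semicolon (sym_part L) x i j m n - semicolon (sym_part L) x i j n m.

Definition ricci (L : pt -> I -> I -> I -> R) (x : pt) (j m : I) : R :=
  \sum_a curv L x a j m a.

Definition calF (L : pt -> I -> I -> I -> R) (s : pt -> I -> R)
    (F : pt -> I -> I -> R) (x : pt) (i j m n : I) : R :=
  let S := sym_part L x in
  let T := torsion L x in
  let w := omega L s F x in
  let ds := cov1_covector L s x in
  let dF := cov1_affinor L F x in
  2^-1 * (ds j n * F x i m + ds m n * F x i j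
          + s x j * dF i m n + s x m * dF i j n)
  - 2^-1 * (ds j m * F x i n + ds n m * F x i j
          + s x j * dF i n m + s x n * dF i j m)
  - 2 * (\sum_a S i a n * S a j m) + 2 * (\sum_a S a j n * S i a m)
  + \sum_a w a j m * L x i a n + \sum_a w i a n * L x a j m
  - \sum_a w i a m * L x a j n - \sum_a w a j n * L x i a m
  - 2 * (\sum_a w i j a * T a m n).

Definition calF_ricci (L : pt -> I -> I -> I -> R) (s : pt -> I -> R)
    (F : pt -> I -> I -> R) (x : pt) (j m : I) : R :=
  \sum_a calF L s F x a j m a.

Definition calW (L : pt -> I -> I -> I -> R) (s : pt -> I -> R)
    (F : pt -> I -> I -> R) (x : pt) (i j m n : I) : R :=
  let Rm := ricci L x in
  let Fm := calF_ricci L s F x in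
  let c1 : R := (N%:R + 1)^-1 in
  let c2 : R := N%:R / (N%:R ^+ 2 - 1) in
  let c3 : R := (N%:R ^+ 2 - 1)^-1 in
  curv L x i j m n
  + c1 * kron i j * (Rm m n - Rm n m)
  + c2 * (kron i m * Rm j n - kron i n * Rm j m)
  + c3 * (kron i m * Rm n j - kron i n * Rm m j)
  + calF L s F x i j m n
  + c1 * kron i j * (Fm m n - Fm n m)
  + c2 * (kron i m * Fm j n - kron i n * Fm j m)
  + c3 * (kron i m * Fm n j - kron i n * Fm m j).

End Coordinates.

Section Manifolds.
Variables (R : realType) (N : nat).
Local Notation I := 'I_N.
Local Notation pt := 'rV[R]_N.

(* [chart_param] is the inverse of [chart_coord], relevant only on the image of
   [chart_dom]. *)
Record chart (M : Type) := Chart {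
  chart_dom : set M;
  chart_coord : M -> pt;
  chart_param : pt -> M }.

Definition is_chart (M : topologicalType) (c : chart M) : Prop :=
  [/\ open (chart_dom c),
      forall p, chart_dom c p -> chart_param c (chart_coord c p) = p &
      (* homeomorphism onto an open subset of R^N *)
      forall A, A `<=` chart_dom c -> (open A <-> open (chart_coord c @` A)) ].

Definition overlap (M : Type) (c d : chart M) : set pt :=
  chart_coord c @` (chart_dom c `&` chart_dom d).

Definition smooth_transition (M : Type) (c d : chart M) : Prop :=
  forall i : I, smooth (overlap c d) (fun y => chart_coord d (chart_param c y) 0 i).

Record manifold := Manifold {
  points :> topologicalType;
  atlas : set (chart points);
  manifold_hausdorff : hausdorff_space points;
  manifold_countable : @second_countable points;
  atlas_chart : forall c, atlas c -> is_chart c;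
  atlas_cover : forall p, exists2 c, atlas c & chart_dom c p;
  atlas_compatible : forall c d, atlas c -> atlas d -> smooth_transition c d;
  atlas_maximal : forall c, is_chart c ->
    (forall d, atlas d -> smooth_transition c d /\ smooth_transition d c) ->
    atlas c }.

(* [jac c d p i a] is the derivative of the i-th coordinate of d with respect
   to the a-th coordinate of c at p; [hess] is the second derivative. *)
Definition jac (M : Type) (c d : chart M) (p : M) (i a : I) : R :=
  partial a (fun y => chart_coord d (chart_param c y) 0 i) (chart_coord c p).

Definition hess (M : Type) (c d : chart M) (p : M) (i a b : I) : R :=
  partial b (partial a (fun y => chart_coord d (chart_param c y) 0 i)) (chart_coord c p).

(* Geometric objects are given by their components, in each chart of the
   atlas, as functions of the coordinates, subject to a transformation law. *)
Record covector_field (M : manifold) := CovectorField {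
  cov_comp :> chart M -> pt -> I -> R;
  cov_smooth : forall c j, atlas c ->
    smooth (chart_coord c @` chart_dom c) (fun x => cov_comp c x j);
  cov_law : forall c d p j, atlas c -> atlas d ->
    chart_dom c p -> chart_dom d p ->
    cov_comp d (chart_coord d p) j
    = \sum_b jac d c p b j * cov_comp c (chart_coord c p) b }.

Record affinor_field (M : manifold) := AffinorField {
  aff_comp :> chart M -> pt -> I -> I -> R;
  aff_smooth : forall c i j, atlas c ->
    smooth (chart_coord c @` chart_dom c) (fun x => aff_comp c x i j);
  aff_law : forall c d p i j, atlas c -> atlas d ->
    chart_dom c p -> chart_dom d p ->
    aff_comp d (chart_coord d p) i j
    = \sum_a \sum_b jac c d p i a * jac d c p b j
        * aff_comp c (chart_coord c p) a b }.

Record tensor12_field (M : manifold) := Tensor12Field {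
  t12_comp :> chart M -> pt -> I -> I -> I -> R;
  t12_smooth : forall c i j k, atlas c ->
    smooth (chart_coord c @` chart_dom c) (fun x => t12_comp c x i j k);
  t12_law : forall c d p i j k, atlas c -> atlas d ->
    chart_dom c p -> chart_dom d p ->
    t12_comp d (chart_coord d p) i j k
    = \sum_a \sum_b \sum_e jac c d p i a * jac d c p b j * jac d c p e k
        * t12_comp c (chart_coord c p) a b e }.

Record connection (M : manifold) := Connection {
  conn_comp :> chart M -> pt -> I -> I -> I -> R;
  conn_smooth : forall c i j k, atlas c ->
    smooth (chart_coord c @` chart_dom c) (fun x => conn_comp c x i j k);
  conn_law : forall c d p i j k, atlas c -> atlas d ->
    chart_dom c p -> chart_dom d p ->
    conn_comp d (chart_coord d p) i j k
    = \sum_a jac c d p i a *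
        (\sum_b \sum_e jac d c p b j * jac d c p e k
           * conn_comp c (chart_coord c p) a b e
         + hess d c p a j k) }.

Definition smooth_map (M M' : manifold) (f : M -> M') : Prop :=
  continuous f /\
  forall (c : chart M) (c' : chart M') (i : I), atlas c -> atlas c' ->
    smooth (chart_coord c @` (chart_dom c `&` f @^-1` chart_dom c'))
           (fun y => chart_coord c' (f (chart_param c y)) 0 i).

Definition diffeomorphism (M M' : manifold) (f : M -> M') (g : M' -> M) : Prop :=
  [/\ cancel f g, cancel g f, smooth_map f & smooth_map g].

(* A coordinate system common with respect to f: corresponding points have
   equal coordinates. *)
Definition common_chart (M M' : manifold) (f : M -> M')
    (c : chart M) (c' : chart M') : Prop :=
  [/\ atlas c, atlas c', chart_dom c = f @^-1` chart_dom c' &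
      forall p, chart_dom c p -> chart_coord c' (f p) = chart_coord c p].

(* The objects determining a second type almost geodesic mapping of the first
   kind defined on M. *)
Record ag_data (M : manifold) := AgData {
  ag_psi : covector_field M;
  ag_sigma : covector_field M;
  ag_mu : covector_field M;
  ag_nu : covector_field M;
  ag_F : affinor_field M;
  ag_xi : tensor12_field M }.

Definition basic_equation (L L' : pt -> I -> I -> I -> R) (psi s : pt -> I -> R)
    (F : pt -> I -> I -> R) (xi : pt -> I -> I -> I -> R) (x : pt) : Prop :=
  forall i j k : I,
    L' x i j k = L x i j k + psi x j * kron R i k + psi x k * kron R i j
      + s x j * F x i k + s x k * F x i j + xi x i j k.

Definition affinor_equation (L : pt -> I -> I -> I -> R) (s mu nu : pt -> I -> R)
    (F : pt -> I -> I -> R) (xi : pt -> I -> I -> I -> R) (x : pt) : Prop :=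
  forall i j k : I,
    cov1_affinor L F x i j k + cov1_affinor L F x i k j
    + (\sum_a F x i a * F x a j) * s x k + (\sum_a F x i a * F x a k) * s x j
    - (\sum_a xi x i j a * F x a k + \sum_a xi x i k a * F x a j)
    = mu x j * F x i k + mu x k * F x i j
      + nu x j * kron R i k + nu x k * kron R i j.

Definition almost_geodesic (M M' : manifold) (f : M -> M')
    (L : connection M) (L' : connection M') (D : ag_data M) : Prop :=
  forall (c : chart M) (c' : chart M') (p : M),
    common_chart f c c' -> chart_dom c p ->
    [/\ forall i j k, ag_xi D c (chart_coord c p) i j k
                      = - ag_xi D c (chart_coord c p) i k j,
        basic_equation (L c) (L' c') (ag_psi D c) (ag_sigma D c) (ag_F D c)
          (ag_xi D c) (chart_coord c p) &
        affinor_equation (L c) (ag_sigma D c) (ag_mu D c) (ag_nu D c)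
          (ag_F D c) (ag_xi D c) (chart_coord c p)].

Definition equitorsion (M M' : manifold) (f : M -> M')
    (L : connection M) (L' : connection M') : Prop :=
  forall (c : chart M) (c' : chart M') (p : M) (i j k : I),
    common_chart f c c' -> chart_dom c p ->
    torsion (L' c') (chart_coord c p) i j k = torsion (L c) (chart_coord c p) i j k.

(* f preserves the affinor, and its inverse g is a mapping of the same kind,
   determined by D'. The identity sigma' = - sigma is not assumed: the two basic
   equations force it wherever the affinor is not a multiple of the identity,
   and elsewhere sigma' = - sigma is one of the admissible choices. *)
Definition reciprocity (M M' : manifold) (f : M -> M') (g : M' -> M)
    (L : connection M) (L' : connection M')
    (D : ag_data M) (D' : ag_data M') : Prop :=
  (forall (c : chart M) (c' : chart M') (p : M) (i j : I),
     common_chart f c c' -> chart_dom c p ->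
     ag_F D' c' (chart_coord c p) i j = ag_F D c (chart_coord c p) i j)
  /\ almost_geodesic g L' L D'.

End Manifolds.

(* Main.v *)
Require Import Defs.
From HB Require Import structures.
From mathcomp Require Import all_boot all_order all_algebra.
From mathcomp Require Import all_classical all_reals all_analysis.
From mathcomp Require Import ring.
Set Implicit Arguments.
Unset Strict Implicit.
Unset Printing Implicit Defensive.
Local Open Scope ring_scope.
Import Order.TTheory GRing.Theory Num.Theory.
Import numFieldNormedType.Exports.

(** The object W is a Weyl projective curvature in disguise.

    Put P^i_jk = s_j F^i_k + s_k F^i_j, let S be the symmetric part of L, and
    let K = S + P/2 ([mean_connection]).  The quadratic terms of the curvature
    are undone by the S S terms of F^i_jmn, and every product of P with L
    coming from the covariant derivatives is undone by the part -P/2 of omega.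
    What survives is linear in K:

      R^i_jmn + F^i_jmn = K^i_jm,n - K^i_jn,m
                          + d^i_n A_jm - d^i_m A_jn - d^i_j (A_mn - A_nm),

    with d the Kronecker symbol and A_jm = u_a L^a_jm, where u is the covector
    of the projective part of omega ([curv_calF]).

    W is obtained from R + F by a linear operator X |-> [weyl X], the usual
    Weyl combination of X with the Kronecker symbol and the traces X^a_jma.
    It kills every expression of the shape displayed above for A
    ([weyl_pure_trace]), so W = weyl (K^i_jm,n - K^i_jn,m) ([calWE]).

    Finally the basic equations of f and of its inverse, symmetrized in the
    lower indices, read S' - S = psi-terms + P and S - S' = psi'-terms + P'.
    Half their difference says that K' - K = chi_j d^i_k + chi_k d^i_j with
    chi = (psi - psi')/2 ([mean_connection_projective]): P and P' are absorbed
    by K and K'.  This holds on a whole coordinate domain, hence may be differentiated, and the resulting change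
    of K^i_jm,n - K^i_jn,m is again of the shape killed by [weyl], with
    A_jm = - chi_j,m ([weyl_curl_projective]). *)

(** * The Weyl projection of a curvature-like array *)

Section WeylProjection.
Variables (R : realType) (N : nat).
Local Notation I := 'I_N.

Lemma kronC (i j : I) : kron R i j = kron R j i.
Proof. by rewrite /kron eq_sym. Qed.

Lemma sum_kronl (i : I) (G : I -> R) : \sum_a kron R i a * G a = G i.
Proof.
rewrite (bigD1 i) //= big1 ?addr0 => [|a ai]; rewrite /kron.
  by rewrite eqxx mul1r.
by rewrite eq_sym (negbTE ai) mul0r.
Qed.

Lemma sum_kronr (i : I) (G : I -> R) : \sum_a kron R a i * G a = G i.
Proof. by rewrite -[RHS]sum_kronl; apply: eq_bigr => a _; rewrite kronC. Qed.

Lemma sum_kron_diag : \sum_(a < N) kron R a a = N%:R.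
Proof.
under eq_bigr do rewrite /kron eqxx.
by rewrite sumr_const card_ord.
Qed.

(** The linear map whose value on the curvature of a symmetric connection is
    the Weyl projective curvature tensor; the trace is the one of [ricci]. *)
Definition weyl (X : I -> I -> I -> I -> R) (i j m n : I) : R :=
  let ric j m := \sum_a X a j m a in
  X i j m n
  + (N%:R + 1)^-1 * kron R i j * (ric m n - ric n m)
  + N%:R / (N%:R ^+ 2 - 1) * (kron R i m * ric j n - kron R i n * ric j m)
  + (N%:R ^+ 2 - 1)^-1 * (kron R i m * ric n j - kron R i n * ric m j).

Lemma eq_weyl X Y : (forall i j m n, X i j m n = Y i j m n) ->
  forall i j m n, weyl X i j m n = weyl Y i j m n.
Proof.
move=> XY i j m n; rewrite /weyl XY.
have ricXY k l : \sum_a X a k l a = \sum_a Y a k l a by exact: eq_bigr.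
by rewrite !ricXY.
Qed.

Lemma weylD X Y i j m n :
  weyl (fun i j m n => X i j m n + Y i j m n) i j m n
  = weyl X i j m n + weyl Y i j m n.
Proof. by rewrite /weyl !big_split /=; ring. Qed.

(** The change of the array K^i_jm,n - K^i_jn,m when chi_j d^i_k + chi_k d^i_j
    is added to K is of this shape, with A_jm = - chi_j,m. *)
Definition pure_trace (A : I -> I -> R) (i j m n : I) : R :=
  kron R i n * A j m - kron R i m * A j n - kron R i j * (A m n - A n m).

Lemma ricci_pure_trace A j m :
  \sum_a pure_trace A a j m a = N%:R * A j m - A m j.
Proof.
rewrite /pure_trace !sumrB -mulr_suml sum_kron_diag !sum_kronr.
by ring.
Qed.

(** The coefficients of [weyl] are the solution of this requirement: by
    [ricci_pure_trace], A is recovered from the trace B_jm = N A_jm - A_mj by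
    A_jm = (N B_jm + B_mj) / (N^2 - 1), and A_mn - A_nm is equal to
    (B_mn - B_nm) / (N + 1). *)
Lemma weyl_pure_trace A i j m n : (1 < N)%N -> weyl (pure_trace A) i j m n = 0.
Proof.
move=> N1; rewrite /weyl !ricci_pure_trace /pure_trace.
have h1 : N%:R + 1 != 0 :> R by rewrite natr1 pnatr_eq0.
have h2 : N%:R ^+ 2 - 1 != 0 :> R.
  by rewrite subr_eq0 -natrX pnatr_eq1 -[1%N](exp1n 2) eqn_sqr gtn_eqF.
by field; rewrite h1 h2.
Qed.

End WeylProjection.

(** * Partial derivatives at a point *)

Section Fields.
Variables (R : realType) (N : nat).
Local Notation I := 'I_N.
Local Notation pt := 'rV[R]_N.

Definition partially_derivable (g : pt -> R) (x : pt) : Prop :=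
  forall k : I, derivable g x (delta_mx 0 k).

Lemma partialD (k : I) (g h : pt -> R) (x : pt) :
  partially_derivable g x -> partially_derivable h x ->
  partial k (fun y => g y + h y) x = partial k g x + partial k h x.
Proof. by move=> dg dh; rewrite /partial -(deriveD (dg k) (dh k)). Qed.

Lemma partialM (k : I) (g h : pt -> R) (x : pt) :
  partially_derivable g x -> partially_derivable h x ->
  partial k (fun y => g y * h y) x = g x * partial k h x + h x * partial k g x.
Proof. by move=> dg dh; rewrite /partial -(deriveM (dg k) (dh k)). Qed.

Lemma partialZ (k : I) (r : R) (g : pt -> R) (x : pt) :
  partially_derivable g x -> partial k (fun y => r * g y) x = r * partial k g x.
Proof. by move=> dg; rewrite /partial -[RHS](deriveZ r (dg k)). Qed.

Lemma partialZr (k : I) (r : R) (g : pt -> R) (x : pt) :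
  partially_derivable g x -> partial k (fun y => g y * r) x = partial k g x * r.
Proof.
by move=> dg; rewrite mulrC -partialZ //; congr partial; apply/funext => y; rewrite mulrC.
Qed.

Lemma pderivableD (g h : pt -> R) (x : pt) :
  partially_derivable g x -> partially_derivable h x ->
  partially_derivable (fun y => g y + h y) x.
Proof. by move=> dg dh k; exact: derivableD. Qed.

Lemma pderivableM (g h : pt -> R) (x : pt) :
  partially_derivable g x -> partially_derivable h x ->
  partially_derivable (fun y => g y * h y) x.
Proof. by move=> dg dh k; exact: derivableM. Qed.

Lemma pderivable_cst (r : R) (x : pt) : partially_derivable (fun=> r) x.
Proof. by move=> k; exact: derivable_cst. Qed.

Arguments pderivable_cst : clear implicits.

(** * Reduction of W to a symmetric connection *)

Definition sym_prod (s : pt -> I -> R) (F : pt -> I -> I -> R)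
    (x : pt) (i j k : I) : R := s x j * F x i k + s x k * F x i j.

Lemma sym_prodC s F x i j k : sym_prod s F x i j k = sym_prod s F x i k j.
Proof. by rewrite /sym_prod addrC. Qed.

(** Up to projective terms, the midpoint of the symmetric parts of L and of its
    image under an almost geodesic mapping determined by s and F: this is why
    its projective class does not distinguish the two spaces. *)
Definition mean_connection (L : pt -> I -> I -> I -> R) (s : pt -> I -> R)
    (F : pt -> I -> I -> R) (x : pt) (i j k : I) : R :=
  sym_part L x i j k + 2^-1 * sym_prod s F x i j k.

Definition curl (K : pt -> I -> I -> I -> R) (x : pt) (i j m n : I) : R :=
  partial n (fun y => K y i j m) x - partial m (fun y => K y i j n) x.

(** The covector u such that omega is u_j d^i_k + u_k d^i_j - P^i_jk / 2. *)
Definition omega_covector (L : pt -> I -> I -> I -> R) (s : pt -> I -> R)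
    (F : pt -> I -> I -> R) (x : pt) (j : I) : R :=
  (N%:R + 1)^-1 * (\sum_a L x a j a + 2^-1 * \sum_a sym_prod s F x a j a).

Section AtPoint.
Variables (L : pt -> I -> I -> I -> R) (s : pt -> I -> R).
Variables (F : pt -> I -> I -> R) (x : pt).
Local Notation P := (sym_prod s F).
Local Notation S := (sym_part L).
Local Notation w := (omega L s F).
Local Notation u := (omega_covector L s F).

Lemma omegaE i j k :
  w x i j k = u x j * kron R i k + u x k * kron R i j - 2^-1 * P x i j k.
Proof.
rewrite /omega /omega_covector /sym_prod !big_split /= -!mulr_sumr invfM.
by ring.
Qed.

Lemma omega_contract_upper j k (G : I -> R) :
  \sum_a w x a j k * G a
  = u x j * G k + u x k * G j - 2^-1 * \sum_a G a * P x a j k.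
Proof.
rewrite -(sum_kronr k G) -(sum_kronr j G) !mulr_sumr -big_split -sumrB /=.
by apply: eq_bigr => a _; rewrite omegaE; ring.
Qed.

Lemma omega_contract_lower i k (G : I -> R) :
  \sum_a w x i a k * G a
  = kron R i k * (\sum_a u x a * G a) + u x k * G i
    - 2^-1 * \sum_a G a * P x i a k.
Proof.
rewrite -(sum_kronl i G) !mulr_sumr -big_split -sumrB /=.
by apply: eq_bigr => a _; rewrite omegaE; ring.
Qed.

Lemma omegaC i j k : w x i j k = w x i k j.
Proof. by rewrite !omegaE sym_prodC; ring. Qed.

Lemma sum_torsion m n (G : I -> R) :
  \sum_a torsion L x a m n * G a
  = 2^-1 * (\sum_a L x a m n * G a - \sum_a L x a n m * G a).
Proof.
by rewrite -sumrB mulr_sumr; apply: eq_bigr => a _; rewrite /torsion; ring.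
Qed.

(** The formal covariant derivative treats S as a tensor, which doubles the
    usual quadratic part of the curvature. *)
Lemma curvE i j m n :
  curv L x i j m n = curl S x i j m n
    + 2 * (\sum_a S x i a n * S x a j m) - 2 * (\sum_a S x a j n * S x i a m).
Proof.
rewrite /curv /semicolon /curl.
have -> : \sum_a S x a n m * S x i j a = \sum_a S x a m n * S x i j a.
  by apply: eq_bigr => a _; rewrite /sym_part; ring.
have -> : \sum_a S x i a m * S x a j n = \sum_a S x a j n * S x i a m.
  by apply: eq_bigr => a _; rewrite mulrC.
have -> : \sum_a S x a j m * S x i a n = \sum_a S x i a n * S x a j m.
  by apply: eq_bigr => a _; rewrite mulrC.
by ring.
Qed.

Hypothesis dL : forall i j k, partially_derivable (fun y => L y i j k) x.
Hypothesis ds : forall j, partially_derivable (fun y => s y j) x.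
Hypothesis dF : forall i j, partially_derivable (fun y => F y i j) x.

Lemma pderivable_sym_part i j k : partially_derivable (fun y => S y i j k) x.
Proof. by apply: pderivableM (pderivable_cst _ _) (pderivableD _ _). Qed.

Lemma pderivable_sym_prod i j k : partially_derivable (fun y => P y i j k) x.
Proof. by apply: pderivableD; apply: pderivableM. Qed.

Lemma pderivable_mean_connection i j k :
  partially_derivable (fun y => mean_connection L s F y i j k) x.
Proof.
apply: pderivableD; first exact: pderivable_sym_part.
by apply: pderivableM (pderivable_cst _ _) (@pderivable_sym_prod _ _ _).
Qed.

Lemma curl_mean_connection i j m n :
  curl (mean_connection L s F) x i j m n
  = curl S x i j m n + 2^-1 * curl P x i j m n.
Proof.
have dP i' j' k' := @pderivable_sym_prod i' j' k'.
have dS i' j' k' := @pderivable_sym_part i' j' k'.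
have dhP i' j' k' := pderivableM (pderivable_cst 2^-1 x) (dP i' j' k').
have partialK k a b c : partial k (fun y => mean_connection L s F y a b c) x
    = partial k (fun y => S y a b c) x + 2^-1 * partial k (fun y => P y a b c) x.
  by rewrite -partialZ // -partialD.
by rewrite /curl !partialK; ring.
Qed.

(** The Leibniz rule for the covariant derivative of the first kind of the
    tensor s_j F^i_m + s_m F^i_j. *)
Lemma cov1_sym_prod i j m n :
  cov1_covector L s x j n * F x i m + cov1_covector L s x m n * F x i j
  + s x j * cov1_affinor L F x i m n + s x m * cov1_affinor L F x i j n
  = partial n (fun y => P y i j m) x
    + \sum_a L x i a n * P x a j m - \sum_a L x a j n * P x i a m
    - \sum_a L x a m n * P x i a j.
Proof.
rewrite /sym_prod partialD; [|exact: pderivableM..].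
rewrite !partialM // /cov1_covector /cov1_affinor.
have -> : \sum_a L x i a n * (s x j * F x a m + s x m * F x a j)
    = s x j * (\sum_a L x i a n * F x a m) + s x m * (\sum_a L x i a n * F x a j).
  by rewrite !mulr_sumr -big_split; apply: eq_bigr => a _ /=; ring.
have e k l : \sum_a L x a k n * (s x a * F x i l + s x l * F x i a)
    = (\sum_a L x a k n * s x a) * F x i l + s x l * (\sum_a L x a k n * F x i a).
  by rewrite mulr_sumr mulr_suml -big_split; apply: eq_bigr => a _ /=; ring.
by rewrite !e; ring.
Qed.

(** Each contraction of P with L coming from [cov1_sym_prod] is matched by one
    from the summand -P/2 of omega; the last of them, sum_a L^a_mn P^i_ja, is
    matched after antisymmetrization in m, n by the torsion term.  Of the
    contractions of u, those of the form u_j L^i_mn cancel among themselves and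
    the traces remain. *)
Lemma curv_calF i j m n :
  curv L x i j m n + calF L s F x i j m n
  = curl (mean_connection L s F) x i j m n
    + pure_trace (fun k l => \sum_a u x a * L x a k l) i j m n.
Proof.
have omega_torsion : \sum_a w x i j a * torsion L x a m n
    = kron R i j * (2^-1 * (\sum_a u x a * L x a m n - \sum_a u x a * L x a n m))
      + u x j * torsion L x i m n
      - 2^-1 * (2^-1 * (\sum_a L x a m n * P x i a j - \sum_a L x a n m * P x i a j)).
  under eq_bigr do rewrite omegaC.
  rewrite omega_contract_lower sum_torsion.
  have -> : \sum_a u x a * torsion L x a m n
    = \sum_a torsion L x a m n * u x a by apply: eq_bigr => a _; rewrite mulrC.
  rewrite sum_torsion; congr (_ * (_ * (_ - _)) + _ - _);
    by apply: eq_bigr => a _; rewrite mulrC.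
rewrite curvE curl_mean_connection /calF !cov1_sym_prod.
rewrite !omega_contract_upper !omega_contract_lower omega_torsion.
rewrite /curl /pure_trace /torsion.
by field.
Qed.

Lemma calWE i j m n : (1 < N)%N ->
  calW L s F x i j m n = weyl (curl (mean_connection L s F) x) i j m n.
Proof.
move=> N1.
transitivity
  (weyl (fun i j m n => curv L x i j m n + calF L s F x i j m n) i j m n).
  by rewrite weylD /calW /weyl /ricci /calF_ricci; ring.
by rewrite (eq_weyl curv_calF) weylD weyl_pure_trace // addr0.
Qed.

End AtPoint.

(** * Projective invariance *)

Lemma weyl_curl_projective (K K' : pt -> I -> I -> I -> R) (chi : pt -> I -> R)
    (x : pt) (i j m n : I) :
  (1 < N)%N ->
  (forall i j k, partially_derivable (fun y => K y i j k) x) ->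
  (forall j, partially_derivable (fun y => chi y j) x) ->
  (\near x, forall i j k,
     K' x i j k = K x i j k + (chi x j * kron R i k + chi x k * kron R i j)) ->
  weyl (curl K' x) i j m n = weyl (curl K x) i j m n.
Proof.
move=> N1 dK dchi KK'.
pose A j m := - partial m (fun y => chi y j) x.
rewrite -[RHS]addr0 -(@weyl_pure_trace R N A i j m n N1) -weylD.
apply: eq_weyl => {}i {}j {}m {}n; rewrite /curl.
have dchik a (b e : I) : partially_derivable (fun y => chi y a * kron R b e) x.
  exact: pderivableM (dchi a) (pderivable_cst _ _).
have partialK' k a b c : partial k (fun y => K' y a b c) x =
    partial k (fun y => K y a b c) x
    + (partial k (fun y => chi y b) x * kron R a c
       + partial k (fun y => chi y c) x * kron R a b).
  rewrite -!partialZr // -!partialD //; last exact: pderivableD.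
  by apply: near_eq_derive; near=> y; apply: (near KK' y).
by rewrite !partialK' /pure_trace /A; ring.
Unshelve. all: by end_near.
Qed.

(** * Common coordinates of an almost geodesic mapping *)

Lemma smooth_pderivable (U : set pt) (g : pt -> R) (x : pt) :
  smooth U g -> U x -> partially_derivable g x.
Proof. by move=> /(_ 1%N)[_ /=] dg Ux k; case: (dg k) => + _; apply. Qed.

(** Symmetrizing the two basic equations removes xi and xi'; half the
    difference of the results expresses S' - S by psi - psi' and P - P', and
    the latter is what K and K' absorb. *)
Lemma mean_connection_projective (L L' : pt -> I -> I -> I -> R)
    (psi psi' s s' : pt -> I -> R) (F F' : pt -> I -> I -> R)
    (xi xi' : pt -> I -> I -> I -> R) (x : pt) :
  (forall i j k, xi x i j k = - xi x i k j) ->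
  (forall i j k, xi' x i j k = - xi' x i k j) ->
  basic_equation L L' psi s F xi x -> basic_equation L' L psi' s' F' xi' x ->
  let chi j := 2^-1 * (psi x j - psi' x j) in
  forall i j k, mean_connection L' s' F' x i j k
    = mean_connection L s F x i j k + (chi j * kron R i k + chi k * kron R i j).
Proof.
move=> axi axi' e e' chi i j k.
have h1 : sym_part L' x i j k = sym_part L x i j k
    + (psi x j * kron R i k + psi x k * kron R i j) + sym_prod s F x i j k.
  by rewrite /sym_part /sym_prod !e (axi i k j); field.
have h2 : sym_part L x i j k = sym_part L' x i j k
    + (psi' x j * kron R i k + psi' x k * kron R i j) + sym_prod s' F' x i j k.
  by rewrite /sym_part /sym_prod !e' (axi' i k j); field.
(* K' = (S' + (S' + P')) / 2, and h2 trades S' + P' for S - psi'-terms. *)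
have -> : mean_connection L' s' F' x i j k
    = 2^-1 * sym_part L' x i j k + 2^-1 * (sym_part L' x i j k
        + (psi' x j * kron R i k + psi' x k * kron R i j) + sym_prod s' F' x i j k)
      - 2^-1 * (psi' x j * kron R i k + psi' x k * kron R i j).
  by rewrite /mean_connection; field.
by rewrite -h2 h1 /mean_connection /chi; field.
Qed.

End Fields.

Lemma common_chart_inv (R : realType) (N : nat) (M M' : manifold R N)
    (f : M -> M') (g : M' -> M) (c : chart R N M) (c' : chart R N M') :
  cancel f g -> cancel g f -> common_chart f c c' -> common_chart g c' c.
Proof.
move=> fK gK [ac ac' dom_f coord_f]; split=> //.
  by rewrite dom_f -comp_preimage (_ : f \o g = id) //; apply/funext.
move=> q qc'; rewrite -[in RHS](gK q) coord_f // dom_f /=.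
by rewrite /preimage /= gK.
Qed.

Theorem theorem2p1 (R : realType) (N : nat) (hN : (1 < N)%N)
  (M M' : manifold R N) (L : connection M) (L' : connection M')
  (f : M -> M') (g : M' -> M) (hfg : diffeomorphism f g)
  (D : ag_data M) (D' : ag_data M')
  (hf : almost_geodesic f L L' D)
  (htor : equitorsion f L L')
  (hrec : reciprocity f g L L' D D')
  (c : chart R N M) (c' : chart R N M') (hc : common_chart f c c')
  (p : M) (hp : chart_dom c p) (i j m n : 'I_N) :
  calW (L' c') (ag_sigma D' c') (ag_F D' c') (chart_coord c' (f p)) i j m n
  = calW (L c) (ag_sigma D c) (ag_F D c) (chart_coord c p) i j m n.
Proof.
have [fK gK _ _] := hfg.
have [ac ac' dom_f coord_f] := hc.
have [_ hg] := hrec.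
have hc' := common_chart_inv fK gK hc.
have dom_c' q : chart_dom c q -> chart_dom c' (f q) by rewrite dom_f.
have Ux : (chart_coord c @` chart_dom c)%classic (chart_coord c p) by exists p.
have Ux' : (chart_coord c' @` chart_dom c')%classic (chart_coord c p).
  by exists (f p); [exact: dom_c'|exact: coord_f].
have openU : open (chart_coord c @` chart_dom c)%classic.
  by have [open_c _ homeo_c] := atlas_chart ac; apply/homeo_c.
set x := chart_coord c p in Ux Ux' *.
have dL i' j' k' := smooth_pderivable (conn_smooth L i' j' k' ac) Ux.
have dL' i' j' k' := smooth_pderivable (conn_smooth L' i' j' k' ac') Ux'.
have dcov (s : covector_field M) j' := smooth_pderivable (cov_smooth s j' ac) Ux.
have dcov' (s : covector_field M') j' := smooth_pderivable (cov_smooth s j' ac') Ux'.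
have dF i' j' := smooth_pderivable (aff_smooth (ag_F D) i' j' ac) Ux.
have dF' i' j' := smooth_pderivable (aff_smooth (ag_F D') i' j' ac') Ux'.
(* Both sides are now evaluated at the common coordinates x. *)
rewrite coord_f // (calWE dL' (dcov' _) dF') // (calWE dL (dcov _) dF) //.
pose chi y k := 2^-1 * (ag_psi D c y k - ag_psi D' c' y k).
apply: (@weyl_curl_projective _ _ _ _ chi) => //.
- by move=> *; exact: pderivable_mean_connection.
- move=> k v; apply: (@derivableM _ _ (fun=> _)); first exact: derivable_cst.
  exact: derivableB (dcov _ _ _) (dcov' _ _ _).
near=> y.
have [q qc <-] : (chart_coord c @` chart_dom c)%classic y.
  by near: y; exact: open_nbhs_nbhs.
have [xi_anti eq_f _] := hf c c' q hc qc.
have [xi_anti' eq_g _] := hg c' c (f q) hc' (dom_c' q qc).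
rewrite coord_f // in xi_anti' eq_g.
exact: mean_connection_projective xi_anti xi_anti' eq_f eq_g.
Unshelve. all: by end_near.
Qed.
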